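(* Let $d\in\mathbb N^+$, $\sigma>0$ and $\epsilon\in(0,1)$. Let $(\mu_t)_{t\in\mathbb N^+}$ be a sequence in $\mathbb R^d$ such that there exists a positive real number $\alpha$ for which $\|\mu_t-\mu_{t'}\|_2\ge (t'-t)\alpha$ for any $t<t'$. Define $S_{t,\epsilon}=\{x\in\mathbb R^d:\|x-\mu_t\|_2\le\sigma\sqrt{d(1+\epsilon)}\}$. Let $\tau$ be a positive integer with $\tau>\frac{2\sigma\sqrt{d(1+\epsilon)}}{\alpha}$, and let $x_t\sim\mathcal N(\mu_t,\sigma^2 I)$ for all $t\in\mathbb N^+$. Then, for any $t\in\mathbb N^+$, with probability at least $1-2\exp(-d\epsilon^2/8)$, the following holds: $x_t\in S_{t,\epsilon}$ and $x_{t+\tau}\notin S_{t,\epsilon}$.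
   Context: $\mathcal N(\mu,\sigma^2 I)$ denotes the $d$-dimensional Gaussian distribution with mean $\mu$ and covariance matrix $\sigma^2 I$, i.e. each coordinate has standard deviation $\sigma$. *)

(* Defs.v *)
From HB Require Import structures.
From mathcomp Require Import all_boot all_order all_algebra.
From mathcomp Require Import all_classical all_reals all_analysis.

Set Implicit Arguments.
Unset Strict Implicit.
Unset Printing Implicit Defensive.

Import Order.TTheory GRing.Theory Num.Theory.
Import numFieldNormedType.Exports.

Local Open Scope classical_set_scope.
Local Open Scope ring_scope.

(* Row vectors carry the product sigma-algebra, generated by the coordinates;
   over R this is the Borel sigma-algebra of R^n.  The construction mirrors the
   library's one for n.-tuple T. *)
Definition measure_rV_display : measure_display -> measure_display.
Proof. exact. Qed.

Section measurable_rV.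
Context {d} {T : measurableType d}.
Variable n : nat.

Let coord : 'I_n -> 'rV[T]_n -> T := fun i x => x ord0 i.

Let rV_set0 : g_sigma_preimage coord set0.
Proof. exact: sigma_algebra0. Qed.

Let rV_setC A : g_sigma_preimage coord A -> g_sigma_preimage coord (~` A).
Proof. exact: sigma_algebraC. Qed.

Let rV_bigcup (F : (set 'rV[T]_n)^nat) :
  (forall i, g_sigma_preimage coord (F i)) ->
  g_sigma_preimage coord (\bigcup_i (F i)).
Proof. exact: sigma_algebra_bigcup. Qed.

HB.instance Definition _ := @isMeasurable.Build (measure_rV_display d)
  'rV[T]_n (g_sigma_preimage coord) rV_set0 rV_setC rV_bigcup.

End measurable_rV.

Lemma measurable_coord d (T : measurableType d) n (i : 'I_n) :
  measurable_fun [set: 'rV[T]_n] (fun x => x ord0 i).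
Proof.
move=> _ Y mY; rewrite setTI; apply: sub_sigma_algebra => /=.
rewrite -bigcup_seq/=; exists i => /=; first by rewrite mem_index_enum.
by exists Y => //; rewrite setTI.
Qed.

Lemma measurable_fun_coordP d1 d2 (T1 : measurableType d1)
    (T2 : measurableType d2) n (f : T1 -> 'rV[T2]_n) :
  measurable_fun [set: T1] f <->
  forall i, measurable_fun [set: T1] (fun x => f x ord0 i).
Proof.
split=> [mf i|mf].
  exact: (measurableT_comp (@measurable_coord _ T2 n i) mf).
suff H : g_sigma_preimage (fun i => (fun v : 'rV[T2]_n => v ord0 i) \o f)
    `<=` measurable.
  by move=> _ A mA; apply: H; rewrite g_sigma_preimage_comp; exists A.
apply: smallest_sub; first exact: sigma_algebra_measurable.
case: n => [|n] in f mf *; first by rewrite big_ord0.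
rewrite -bigcup_mkord_ord; apply: bigcup_sub => i Ii.
by move=> A [B mB <-]; exact: mf.
Qed.

Section lebesgue_rV.
Variable R : realType.

Definition rV_cons n (p : measurableTypeR R * 'rV[R]_n) : 'rV[R]_n.+1 :=
  row_mx (p.1)%:M p.2.

Definition rV_uncons n (v : 'rV[R]_n.+1) : measurableTypeR R * 'rV[R]_n :=
  (v ord0 ord0, @rsubmx R 1 1 n v).

Lemma rV_consK n : cancel (@rV_cons n) (@rV_uncons n).
Proof.
move=> [x v]; rewrite /rV_uncons /rV_cons /= row_mxKr; congr pair.
rewrite [LHS](_ : _ = row_mx x%:M v ord0 (lshift n ord0)).
  by rewrite row_mxEl mxE eqxx mulr1n.
by congr (row_mx _ _ _ _); exact/val_inj.
Qed.

Lemma measurable_rV_cons n : measurable_fun setT (@rV_cons n).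
Proof.
apply/measurable_fun_coordP => i; rewrite /rV_cons.
case: (@split_ordP 1 n i) => j ->.
  under eq_fun do rewrite (@row_mxEl _ 1 1 n) [j]ord1 mxE mulr1n.
  exact: measurable_fst.
under eq_fun do rewrite (@row_mxEr _ 1 1 n).
by apply: (measurableT_comp (measurable_coord j)); exact: measurable_snd.
Qed.

Lemma measurable_rV_uncons n : measurable_fun setT (@rV_uncons n).
Proof.
apply: measurable_fun_pair; first exact: measurable_coord.
apply/measurable_fun_coordP => i.
under eq_fun do rewrite mxE.
exact: measurable_coord.
Qed.

Section pushforward_rV_cons.
Variables (n : nat) (m : {sigma_finite_measure set 'rV[R]_n -> \bar R}).

Definition rV_cons_measure : set 'rV[R]_n.+1 -> \bar R :=
  pushforward (@lebesgue_measure R \x m)%E (@rV_cons n).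

Let rV_cons_measure0 : rV_cons_measure set0 = 0%E.
Proof. by rewrite /rV_cons_measure /pushforward preimage_set0 measure0. Qed.

Let rV_cons_measure_ge0 A : (0 <= rV_cons_measure A)%E.
Proof. by rewrite /rV_cons_measure /pushforward; exact: measure_ge0. Qed.

Let rV_cons_measure_sigma_additive : semi_sigma_additive rV_cons_measure.
Proof.
move=> F mF tF mUF; rewrite /rV_cons_measure /pushforward preimage_bigcup.
apply: measure_semi_sigma_additive.
- by move=> k; rewrite -[X in measurable X]setTI; exact: measurable_rV_cons.
- apply/trivIsetP => /= i j _ _ ij; rewrite -preimage_setI.
  by move/trivIsetP : tF => ->//; rewrite preimage_set0.
- rewrite -preimage_bigcup -[X in measurable X]setTI.
  exact: measurable_rV_cons.
Qed.

HB.instance Definition _ := isMeasure.Build _ _ _ rV_cons_measure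
  rV_cons_measure0 rV_cons_measure_ge0 rV_cons_measure_sigma_additive.

Let rV_cons_measure_sigma_finite : sigma_finite setT rV_cons_measure.
Proof.
have /sigma_finiteP[F [TF ndF Foo]] := sigma_finiteT (@lebesgue_measure R).
have /sigma_finiteP[G [TG ndG Goo]] := sigma_finiteT m.
exists (fun k => @rV_uncons n @^-1` (F k `*` G k)).
  rewrite -preimage_bigcup -[LHS](@preimage_setT _ _ (@rV_uncons n)).
  congr (_ @^-1` _); rewrite -setXTT TF TG predeqE => -[x y]; split.
    move=> [/= [i _ Fix] [k _ Gky]]; exists (maxn i k) => //; split.
    - by move: x Fix; exact/subsetPset/ndF/leq_maxl.
    - by move: y Gky; exact/subsetPset/ndG/leq_maxr.
  by move=> [k _ []/= ? ?]; split; exists k.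
move=> k; have [mFk Fk] := Foo k; have [mGk Gk] := Goo k.
have mFG : measurable (F k `*` G k) by exact: measurableX.
split.
  by rewrite -[X in measurable X]setTI; exact: measurable_rV_uncons.
rewrite /rV_cons_measure /pushforward -comp_preimage.
rewrite (_ : _ \o _ = id) ?preimage_id; last exact/funext/rV_consK.
by rewrite product_measure1E// lte_mul_pinfty// ge0_fin_numE.
Qed.

HB.instance Definition _ := Measure_isSigmaFinite.Build _ _ _ rV_cons_measure
  rV_cons_measure_sigma_finite.

End pushforward_rV_cons.

(* n-dimensional Lebesgue measure, as the iterated product of the
   one-dimensional one; on the one-point space R^0 it is the unit mass. *)
Fixpoint lebesgue_rV n : {sigma_finite_measure set 'rV[R]_n -> \bar R} :=
  match n with
  | 0 => \d_(0 : 'rV[R]_0)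
  | n'.+1 => rV_cons_measure (lebesgue_rV n')
  end.

End lebesgue_rV.

Section multivariate_normal.
Variables (R : realType) (d : nat).
Implicit Types (mu x : 'rV[R]_d) (Sigma : 'M[R]_d).

(* Only meaningful for a symmetric positive definite covariance matrix Sigma. *)
Definition mnormal_pdf mu Sigma x : R :=
  (Num.sqrt ((2 * pi) ^+ d * \det Sigma))^-1 *
  expR (- ((x - mu) *m invmx Sigma *m (x - mu)^T) ord0 ord0 / 2).

Definition mnormal_prob mu Sigma (A : set 'rV[R]_d) : \bar R :=
  (\int[lebesgue_rV R d]_(x in A) (mnormal_pdf mu Sigma x)%:E)%E.

(* The library norm `|x| on row vectors is the sup norm. *)
Definition norm2 x : R := Num.sqrt (\sum_(i < d) x ord0 i ^+ 2).

Definition confidence_ball (sigma eps : R) mu : set 'rV[R]_d :=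
  [set x | norm2 (x - mu) <= sigma * Num.sqrt (d%:R * (1 + eps))].

Definition mnormal_distributed disp (T : measurableType disp)
    (P : probability T R) (X : {RV P >-> 'rV[R]_d}) mu Sigma : Prop :=
  forall A, measurable A -> distribution P X A = mnormal_prob mu Sigma A.

End multivariate_normal.

(* Main.v *)
(* The mean moves by more than two radii in [tau] steps, so the balls around
   [mu t] and [mu (t + tau)] are disjoint: the event fails only if [x t] or
   [x (t + tau)] leaves its own confidence ball.  Each of these has probability
   at most [exp (- d eps^2 / 8)]: off the ball, the density of N(mu, sigma^2 I)
   is at most [((1 + eps) exp (- eps)) ^ (d / 2)] times that of
   N(mu, sigma^2 (1 + eps) I), which integrates to 1. *)
Require Import Defs.
From mathcomp Require Import all_boot all_order all_algebra.
From mathcomp Require Import all_classical all_reals all_analysis.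
From mathcomp Require Import measurable_realfun ring lra.

Set Implicit Arguments.
Unset Strict Implicit.
Unset Printing Implicit Defensive.

Import Order.TTheory GRing.Theory Num.Theory.
Import numFieldNormedType.Exports.

Local Open Scope classical_set_scope.
Local Open Scope ring_scope.

(** * Elementary exponential inequalities *)

Section exponential_bounds.
Variable R : realType.
Implicit Types u eps : R.

(* Squaring the bound at [u / 2] doubles the precision, starting from
   [1 + u <= expR u]. *)
Lemma expR_ge_quadratic k u : 0 <= u ->
  1 + u + (1 - 2 ^- k) / 2 * u ^+ 2 <= expR u.
Proof.
elim: k u => [|k IHk] u u0.
  by rewrite expr0 invr1 subrr !mul0r addr0 expR_ge1Dx.
have {}IHk := IHk (u / 2) ltac:(lra).
have -> : expR u = expR (u / 2) ^+ 2 by rewrite -expRM_natl; congr expR; field.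
have k1 : 2 ^- k <= 1 :> R by rewrite -exprVn exprn_ile1//; lra.
rewrite exprS invfM; move: (2 ^- k) k1 IHk => c c1 IHk.
apply: le_trans (_ : (1 + u / 2 + (1 - c) / 2 * (u / 2) ^+ 2) ^+ 2 <= _).
  set a := (1 - c) / 2; have a0 : 0 <= a by rewrite /a; lra.
  (* This is exactly the excess of the square over the target: the [u ^+ 2] coefficients agree
     because [1/4 + a/2 = (1 - c/2)/2]. *)
  have p0 : 0 <= a * u ^+ 3 / 4 + (a * (u / 2) ^+ 2) ^+ 2.
    by rewrite addr_ge0 ?sqr_ge0// divr_ge0// mulr_ge0 ?exprn_ge0.
  by rewrite -subr_ge0; congr (_ <= _): p0; rewrite /a; field.
rewrite ler_sqr ?nnegrE ?expR_ge0// addr_ge0 ?mulr_ge0 ?sqr_ge0//; lra.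
Qed.

Lemma le1D_expR eps : 0 < eps -> eps < 1 -> 1 + eps <= expR (eps - eps ^+ 2 / 4).
Proof.
move=> e0 e1; have u0 : 0 <= eps - eps ^+ 2 / 4 by nra.
(* With [u = eps (1 - eps/4)] and [eps < 1], the square [u^2] exceeds [9/16 eps^2], so a coefficient
   of at least [4/9] absorbs the missing [eps^2 / 4]; [k = 4] gives [15/32], while [k = 3] gives
   only [7/16]. *)
apply: le_trans (expR_ge_quadratic 4 u0).
have -> : (1 - 2 ^- 4) / 2 = 15 / 32 :> R by field.
nra.
Qed.

Lemma sqrt_expR u : Num.sqrt (expR u) = expR (u / 2).
Proof.
have -> : expR u = expR (u / 2) ^+ 2 by rewrite -expRM_natl; congr expR; field.
by rewrite sqrtr_sqr ger0_norm ?expR_ge0.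
Qed.

(** Once the exponential is moved to the right, this is the square root of the [n]-th power of
    [le1D_expR]. *)
Lemma sqrt_mul_expR_le n eps : 0 < eps -> eps < 1 ->
  Num.sqrt ((1 + eps) ^+ n) * expR (- (n%:R * eps / 2)) <=
  expR (- (n%:R * eps ^+ 2 / 8)).
Proof.
move=> e0 e1; rewrite -ler_pdivlMr ?expR_gt0// -expRN opprK -expRD.
have -> : - (n%:R * eps ^+ 2 / 8) + n%:R * eps / 2 =
    n%:R * (eps - eps ^+ 2 / 4) / 2 by field.
rewrite -sqrt_expR ler_wsqrtr// expRM_natl lerXn2r ?nnegrE ?expR_ge0 ?le1D_expR//.
lra.
Qed.

End exponential_bounds.

(** * Iterated integration on row vectors and products of normal densities *)

Section isotropic_gaussian.
Variable R : realType.
Implicit Types (v eps sigma : R).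

(** The measure is a pushforward of a product along [rV_cons], so a change of variables followed by
    Tonelli suffices. *)
Lemma ge0_integral_lebesgue_rVS n (f : 'rV[R]_n.+1 -> \bar R) :
  measurable_fun [set: 'rV[R]_n.+1] f -> (forall x, 0 <= f x)%E ->
  (\int[lebesgue_rV R n.+1]_x f x =
   \int[@lebesgue_measure R]_x \int[lebesgue_rV R n]_y f (rV_cons (x, y)))%E.
Proof.
move=> mf f0.
rewrite /= /rV_cons_measure ge0_integral_pushforward//; last first.
  exact: measurable_rV_cons.
rewrite preimage_setT fubini_tonelli1//; last by move=> x; exact: f0.
exact: (measurableT_comp mf (@measurable_rV_cons R n)).
Qed.

Lemma rV_cons_ord0 n (x : R) (y : 'rV[R]_n) : rV_cons (x, y) ord0 ord0 = x.
Proof. exact: (congr1 fst (rV_consK (x, y))). Qed.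

Lemma rV_cons_lift n (x : R) (y : 'rV[R]_n) i :
  rV_cons (x, y) ord0 (lift ord0 i) = y ord0 i.
Proof.
have -> : lift ord0 i = rshift 1 i :> 'I_n.+1 by exact/val_inj.
exact: row_mxEr.
Qed.

Lemma measurable_prod_normal_pdf n (m : 'I_n -> R) s :
  measurable_fun [set: 'rV[R]_n]
    (fun x : 'rV[R]_n => \prod_(i < n) normal_pdf (m i) s (x ord0 i)).
Proof.
apply: measurable_prod => i _.
exact: (measurableT_comp (measurable_normal_pdf _ _) (measurable_coord i)).
Qed.

(** Induction on the dimension: integrating out the tail leaves the one-dimensional density of the
    head. In dimension 0 the unit mass integrates an empty product. *)
Lemma integral_prod_normal_pdf n (m : 'I_n -> R) s :
  (\int[lebesgue_rV R n]_x (\prod_(i < n) normal_pdf (m i) s (x ord0 i))%:E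
   = 1)%E.
Proof.
elim: n m => [|n IHn] m.
  rewrite /= integral_dirac//; last first.
    by apply/measurable_EFinP; apply: measurable_prod_normal_pdf.
  by rewrite diracT big_ord0 mul1e.
rewrite ge0_integral_lebesgue_rVS; last 2 first.
- by apply/measurable_EFinP; apply: measurable_prod_normal_pdf.
- by move=> x; rewrite lee_fin prodr_ge0// => i _; exact: normal_pdf_ge0.
rewrite -[RHS](integral_normal_pdf (m ord0) s); apply: eq_integral => x _.
pose f (y : 'rV[R]_n) := \prod_(i < n) normal_pdf (m (lift ord0 i)) s (y ord0 i).
transitivity (\int[lebesgue_rV R n]_y ((normal_pdf (m ord0) s x)%:E * (f y)%:E))%E.
  apply: eq_integral => y _; rewrite -EFinM big_ord_recl rV_cons_ord0.
  by congr (_ * _)%:E; apply: eq_bigr => i _; rewrite rV_cons_lift.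
rewrite ge0_integralZl//; last 3 first.
- by apply/measurable_EFinP; exact: measurable_prod_normal_pdf.
- by move=> y _; rewrite lee_fin prodr_ge0// => i _; exact: normal_pdf_ge0.
- by rewrite lee_fin normal_pdf_ge0.
by rewrite IHn mule1.
Qed.

(** * The isotropic normal density and its total mass *)

Lemma norm2_sqr n (x : 'rV[R]_n) : norm2 x ^+ 2 = \sum_(i < n) x ord0 i ^+ 2.
Proof. by rewrite sqr_sqrtr// sumr_ge0// => i _; exact: sqr_ge0. Qed.

Lemma mnormal_pdf_isotropic n (mu : 'rV[R]_n) v x : 0 < v ->
  mnormal_pdf mu (v *: 1%:M) x =
  (Num.sqrt ((2 * pi * v) ^+ n))^-1 * expR (- (norm2 (x - mu) ^+ 2 / (2 * v))).
Proof.
move=> v0; rewrite /mnormal_pdf detZ det1 mulr1 -exprMn; congr (_ * expR _).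
rewrite invmxZ ?unitmxZ ?unitmx1 ?unitfE ?gt_eqF// invmx1.
rewrite -scalemxAr mulmx1 -scalemxAl mxE.
have -> : ((x - mu) *m (x - mu)^T) ord0 ord0 = norm2 (x - mu) ^+ 2.
  by rewrite mxE norm2_sqr; apply: eq_bigr => i _; rewrite [_^T _ _]mxE -expr2.
by field; rewrite gt_eqF.
Qed.

(** A scalar covariance makes the exponent a sum over coordinates; measurability and total mass then
    reduce to the one-dimensional density. *)
Lemma mnormal_pdf_prod n (mu : 'rV[R]_n) v x : 0 < v ->
  mnormal_pdf mu (v *: 1%:M) x =
  \prod_(i < n) normal_pdf (mu ord0 i) (Num.sqrt v) (x ord0 i).
Proof.
move=> v0; rewrite mnormal_pdf_isotropic//.
under eq_bigr do rewrite normal_pdfE ?sqrtr_eq0 -?ltNge//.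
rewrite big_split/= prodr_const card_ord; congr (_ * _).
  rewrite /normal_peak sqr_sqrtr ?ltW// exprVn; congr (_^-1).
  have -> : v * pi *+ 2 = 2 * pi * v by rewrite -mulr_natl; ring.
  have : 0 <= 2 * pi * v by rewrite !mulr_ge0 ?pi_ge0 ?ltW.
  move: (_ * v) => a a0; elim: n {mu x} => [|n IHn]; first by rewrite !expr0 sqrtr1.
  by rewrite !exprS sqrtrM// IHn.
rewrite -expR_sum norm2_sqr; congr expR.
rewrite mulr_suml -sumrN; apply: eq_bigr => i _.
by rewrite !mxE sqr_sqrtr ?ltW// -[v *+ 2]mulr_natl mulNr.
Qed.

Lemma measurable_mnormal_pdf n (mu : 'rV[R]_n) v : 0 < v ->
  measurable_fun [set: 'rV[R]_n] (mnormal_pdf mu (v *: 1%:M)).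
Proof.
move=> v0; apply: eq_measurable_fun (measurable_prod_normal_pdf (mu ord0) (Num.sqrt v)).
by move=> x _; rewrite mnormal_pdf_prod.
Qed.

Lemma integral_mnormal_pdf n (mu : 'rV[R]_n) v : 0 < v ->
  mnormal_prob mu (v *: 1%:M) setT = 1%E.
Proof.
move=> v0; rewrite -(integral_prod_normal_pdf (mu ord0) (Num.sqrt v)).
by apply: eq_integral => x _; rewrite mnormal_pdf_prod.
Qed.

(** * Confidence balls and the Gaussian tail outside them *)

(** Squaring removes the roots, which makes membership a polynomial condition; as an equality in
    [Prop] it also rewrites under a negation. *)
Lemma confidence_ballE n sigma eps (mu x : 'rV[R]_n) : 0 <= sigma -> 0 <= eps ->
  confidence_ball sigma eps mu x =
  (\sum_(i < n) (x - mu) ord0 i ^+ 2 <= sigma ^+ 2 * (n%:R * (1 + eps))) :> Prop.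
Proof.
move=> s0 e0; rewrite /confidence_ball/=; congr is_true.
have d0 : 0 <= n%:R * (1 + eps) by rewrite mulr_ge0// addr_ge0.
rewrite -norm2_sqr -(ler_pXn2r (n := 2))// ?nnegrE ?sqrtr_ge0//; last first.
  by rewrite mulr_ge0 ?sqrtr_ge0.
by rewrite exprMn [Num.sqrt (_ * _) ^+ 2]sqr_sqrtr.
Qed.

Lemma measurable_confidence_ball n sigma eps (mu : 'rV[R]_n) :
  0 <= sigma -> 0 <= eps ->
  measurable (confidence_ball sigma eps mu : set 'rV[R]_n).
Proof.
move=> s0 e0.
rewrite (_ : confidence_ball _ _ _ =
  (fun x : 'rV[R]_n => \sum_(i < n) (x - mu) ord0 i ^+ 2) @^-1`
  [set` `]-oo, sigma ^+ 2 * (n%:R * (1 + eps))]]); last first.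
  by apply/funext => x; rewrite confidence_ballE//= in_itv.
rewrite -[X in measurable X]setTI.
apply: (@measurable_sum _ 'rV[R]_n R) => //.
move=> i; apply: measurable_funX.
under eq_fun do rewrite !mxE.
by apply: measurable_funB => //; exact: measurable_coord.
Qed.

(* The variance [sigma ^+ 2 * (1 + eps)] is the one given by the optimal
   exponential tilt in Chernoff's bound. *)
Lemma mnormal_pdf_le n sigma eps (mu x : 'rV[R]_n) :
  0 < sigma -> 0 < eps -> eps < 1 -> ~ confidence_ball sigma eps mu x ->
  mnormal_pdf mu (sigma ^+ 2 *: 1%:M) x <=
  expR (- (n%:R * eps ^+ 2 / 8)) *
  mnormal_pdf mu ((sigma ^+ 2 * (1 + eps)) *: 1%:M) x.
Proof.
move=> s0 e0 e1; rewrite (confidence_ballE _ _ (ltW s0) (ltW e0)) => /negP; rewrite -ltNge => xball.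
have v0 : 0 < sigma ^+ 2 by rewrite exprn_gt0.
have e10 : 0 < 1 + eps by lra.
rewrite !mnormal_pdf_isotropic// ?mulr_gt0//.
move: xball; rewrite norm2_sqr; move: (\sum_(_ < _) _) => q.
move: (sigma ^+ 2) v0 => v v0 qv.
(* It is enough to prove the bound with the sharper Chernoff factor
   [sqrt ((1 + eps)^n) exp (- n eps / 2)], whose root cancels against the normalisation of the wider
   Gaussian. *)
apply: le_trans; last first.
  apply: ler_wpM2r (sqrt_mul_expR_le n e0 e1).
  by rewrite mulr_ge0 ?expR_ge0 ?invr_ge0 ?sqrtr_ge0.
have p0 : 0 < 2 * pi * v by rewrite !mulr_gt0 ?pi_gt0.
have -> : Num.sqrt ((2 * pi * (v * (1 + eps))) ^+ n) =
    Num.sqrt ((2 * pi * v) ^+ n) * Num.sqrt ((1 + eps) ^+ n).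
  by rewrite mulrA [in LHS]exprMn sqrtrM// exprn_ge0// ltW.
have a0 : Num.sqrt ((2 * pi * v) ^+ n) != 0 by rewrite gt_eqF ?sqrtr_gt0 ?exprn_gt0.
have b0 : Num.sqrt ((1 + eps) ^+ n) != 0 by rewrite gt_eqF ?sqrtr_gt0 ?exprn_gt0.
rewrite [leRHS](_ : _ = (Num.sqrt ((2 * pi * v) ^+ n))^-1 *
  (expR (- (n%:R * eps / 2)) * expR (- (q / (2 * (v * (1 + eps))))))); last first.
  by field; rewrite a0.
rewrite -expRD ler_wpM2l ?invr_ge0 ?sqrtr_ge0// ler_expR.
rewrite -subr_ge0.
(* The difference of the exponents has the sign of [q - v n (1 + eps)], which is positive off the
   ball. *)
have -> : - (n%:R * eps / 2) - q / (2 * (v * (1 + eps))) - - (q / (2 * v)) =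
   (q - v * (n%:R * (1 + eps))) * eps / (2 * v * (1 + eps)).
  by field; rewrite !gt_eqF.
by rewrite divr_ge0 ?mulr_ge0// ?subr_ge0 ltW.
Qed.

(** Integrate [mnormal_pdf_le] off the ball, then enlarge the domain to the whole space, where the
    wider Gaussian has mass 1. *)
Lemma mnormal_prob_confidence_ballC n sigma eps (mu : 'rV[R]_n) :
  0 < sigma -> 0 < eps -> eps < 1 ->
  (mnormal_prob mu (sigma ^+ 2 *: 1%:M) (~` confidence_ball sigma eps mu) <=
   (expR (- (n%:R * eps ^+ 2 / 8)))%:E)%E.
Proof.
move=> s0 e0 e1.
have v0 : 0 < sigma ^+ 2 by rewrite exprn_gt0.
have w0 : 0 < sigma ^+ 2 * (1 + eps) by rewrite mulr_gt0//; lra.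
have pdf_ge0 v (x : 'rV[R]_n) : 0 <= mnormal_pdf mu (v *: 1%:M) x.
  by rewrite mulr_ge0 ?expR_ge0 ?invr_ge0 ?sqrtr_ge0.
rewrite -[leRHS]mule1 -(integral_mnormal_pdf mu w0) /mnormal_prob.
have mB : measurable (~` confidence_ball sigma eps mu : set 'rV[R]_n).
  by apply: measurableC; apply: measurable_confidence_ball; exact: ltW.
rewrite -ge0_integralZl//; last 2 first.
- by apply/measurable_EFinP; apply: measurable_mnormal_pdf.
- by move=> x _; rewrite lee_fin.
apply: (@le_trans _ _ (\int[lebesgue_rV R n]_(x in ~` confidence_ball sigma eps mu)
  ((expR (- (n%:R * eps ^+ 2 / 8)))%:E *
   (mnormal_pdf mu ((sigma ^+ 2 * (1 + eps)) *: 1%:M) x)%:E))%E).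
  apply: ge0_le_integral => //.
  - by move=> x _; rewrite lee_fin.
  - apply: measurable_funTS; apply/measurable_EFinP.
    exact: measurable_mnormal_pdf.
  - apply: measurable_funTS; apply: measurable_funeM.
    by apply/measurable_EFinP; apply: measurable_mnormal_pdf.
  - by move=> x xB; rewrite -EFinM lee_fin mnormal_pdf_le.
apply: ge0_subset_integral => //.
- apply: measurable_funeM; apply/measurable_EFinP.
  exact: measurable_mnormal_pdf.
- by move=> x _; rewrite mule_ge0 ?lee_fin ?expR_ge0.
Qed.

Lemma mnormal_confidence_ballC n sigma eps (mu : 'rV[R]_n)
    disp (T : measurableType disp) (P : probability T R)
    (X : {RV P >-> 'rV[R]_n}) :
  0 < sigma -> 0 < eps -> eps < 1 ->
  mnormal_distributed X mu (sigma ^+ 2 *: 1%:M) ->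
  (P (X @^-1` (~` confidence_ball sigma eps mu)) <=
   (expR (- (n%:R * eps ^+ 2 / 8)))%:E)%E.
Proof.
move=> s0 e0 e1 HX; apply: le_trans (mnormal_prob_confidence_ballC mu s0 e0 e1).
rewrite -HX//; apply: measurableC.
by apply: measurable_confidence_ball; exact: ltW.
Qed.

(** As both radii equal the same [r], the bound [|a - b|^2 <= 2 (|a|^2 + |b|^2) <= (2 r)^2] replaces
    the triangle inequality and can be checked coordinatewise. *)
Lemma norm2B_confidence_ball n sigma eps (mu nu x : 'rV[R]_n) :
  0 <= sigma -> 0 <= eps ->
  confidence_ball sigma eps mu x -> confidence_ball sigma eps nu x ->
  norm2 (mu - nu) <= 2 * sigma * Num.sqrt (n%:R * (1 + eps)).
Proof.
move=> s0 e0; rewrite !confidence_ballE// => Hmu Hnu.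
have d0 : 0 <= n%:R * (1 + eps) by rewrite mulr_ge0// addr_ge0.
rewrite -(ler_pXn2r (n := 2))// ?nnegrE ?sqrtr_ge0 ?mulr_ge0 ?sqrtr_ge0//.
rewrite norm2_sqr !exprMn sqr_sqrtr//.
apply: (@le_trans _ _ (2 * (\sum_(i < n) (x - mu) ord0 i ^+ 2 +
                            \sum_(i < n) (x - nu) ord0 i ^+ 2))); last lra.
rewrite -big_split mulr_sumr/=; apply: ler_sum => i _; rewrite !mxE.
(* The gap [2 a^2 + 2 b^2 - (a - b)^2] equals [(a + b)^2]. *)
have := sqr_ge0 (x ord0 i - mu ord0 i + (x ord0 i - nu ord0 i)); nra.
Qed.

End isotropic_gaussian.

(** * Union bound over the two sampling times *)

Theorem proposition6p1 (R : realType) (d : nat) (hd : (0 < d)%N)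
  (sigma eps : R) (hsigma : 0 < sigma) (heps0 : 0 < eps) (heps1 : eps < 1)
  (mu : nat -> 'rV[R]_d) (alpha : R) (halpha : 0 < alpha)
  (hmu : forall t t' : nat, (0 < t)%N -> (t < t')%N ->
    (t'%:R - t%:R) * alpha <= norm2 (mu t - mu t'))
  (tau : nat) (htau0 : (0 < tau)%N)
  (htau : 2 * sigma * Num.sqrt (d%:R * (1 + eps)) / alpha < tau%:R)
  (disp : measure_display) (T : measurableType disp) (P : probability T R)
  (x : nat -> {RV P >-> 'rV[R]_d})
  (hx : forall t : nat, (0 < t)%N ->
    mnormal_distributed (x t) (mu t) ((sigma ^+ 2) *: 1%:M))
  (t : nat) (ht : (0 < t)%N) :
  ((1 - 2 * expR (- (d%:R * eps ^+ 2 / 8)))%:E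
    <= P [set w | confidence_ball sigma eps (mu t) (x t w) /\
                  ~ confidence_ball sigma eps (mu t) (x (t + tau)%N w)])%E.
Proof.
set q := expR _.
have htt : (0 < t + tau)%N by rewrite addn_gt0 ht.
(* The ball stays centred at [mu t]; only the sampling time [s] varies. *)
pose B s := x s @^-1` confidence_ball sigma eps (mu t).
have mB s : measurable (B s).
  rewrite -[B s]setTI; apply: measurable_funPT => //.
  by apply: measurable_confidence_ball; exact: ltW.
rewrite (_ : [set w | _] = B t `&` ~` B (t + tau)%N)//.
have -> : B t `&` ~` B (t + tau)%N = ~` (~` B t `|` B (t + tau)%N).
  by rewrite setCU setCK.
rewrite probability_setC; last exact: measurableU (measurableC _) _.
rewrite EFinB leeB//.
apply: le_trans; first by apply: measureU2 => //; exact: measurableC.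
rewrite mulr_natl mulr2n EFinD leeD//.
  exact: (mnormal_confidence_ballC hsigma heps0 heps1 (hx _ ht)).
(* A sample at time [t + tau] inside the ball around [mu t] must lie outside its own ball. *)
apply: le_trans (mnormal_confidence_ballC hsigma heps0 heps1 (hx _ htt)).
apply: le_measure; rewrite ?inE//.
  rewrite -[X in measurable X]setTI; apply: measurable_funPT => //.
  by apply: measurableC; apply: measurable_confidence_ball; exact: ltW.
move=> w Bt /= Btau.
have := norm2B_confidence_ball (ltW hsigma) (ltW heps0) Bt Btau.
apply/negP; rewrite -ltNge.
(* A common point would put the centres within two radii, but they are at least [tau * alpha] apart,
   which is more by [htau]. *)
apply: lt_le_trans (hmu _ _ ht (_ : (t < t + tau)%N)); last first.
  by rewrite -addn1 leq_add2l.
by rewrite natrD addrAC subrr add0r -ltr_pdivrMr.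
Qed.
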